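(* Let $\bar x\in\mathcal F$ be a feasible point of the problem $(P)$: minimize $f(x)$ over $x\in C$ subject to $G(x)\in K$. Then the following statements hold: (a) If $\bar x$ is an s-AKKT point of $(P)$ and $\bar x$ is s-AKKT regular, then $\bar x$ is a KKT point of $(P)$. (b) Conversely, if for every continuously differentiable function $f\colon X\to\mathbb R$ the implication ''$\bar x$ is an s-AKKT point of $(P)$ $\Longrightarrow$ $\bar x$ is a KKT point of $(P)$'' holds (with $C$, $K$, $G$ fixed and $f$ as the objective), then $\bar x$ is s-AKKT regular.
   Context: Setting: $X$ and $Y$ are real Banach spaces, $f\colon X\to\mathbb R$ and $G\colon X\to Y$ are continuously Fréchet differentiable, $C\subset X$ and $K\subset Y$ are nonempty, closed, convex sets. Problem $(P)$: minimize $f(x)$ over $x\in C$ subject to $G(x)\in K$; its feasible set is $\mathcal F:=\{x\in C\mid G(x)\in K\}$. For a closed convex set $S$, $\mathcal N_S(x):=\{v\mid \langle v,z-x\rangle\le 0\ \forall z\in S\}$ (a subset of the dual space) for $x\in S$ and $\mathcal N_S(x):=\varnothing$ for $x\notin S$. The Lagrangian is $L(x,\lambda):=f(x)+\langle\lambda,G(x)\rangle_Y$ for $x\in X$, $\lambda\in Y^*$. A point $\bar x\in\mathcal F$ is a KKT point of $(P)$ if there is $\bar\lambda\in Y^*$ with $-L'_x(\bar x,\bar\lambda)\in\mathcal N_C(\bar x)$ and $\bar\lambda\in\mathcal N_K(G(\bar x))$. A point $\bar x\in\mathcal F$ is an s-AKKT point of $(P)$ if there are sequences $\{(x^k,\lambda^k)\}\subset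 C\times Y^*$, $\{\varepsilon^k\}\subset X^*$, $\{r^k\}\subset[0,+\infty)$ with $x^k\to\bar x$, $\varepsilon^k\to0$, $r^k\to0$ such that for all $k$: $\varepsilon^k-L'_x(x^k,\lambda^k)\in\mathcal N_C(x^k)$ and $\langle\lambda^k,y-G(x^k)\rangle_Y\le r^k$ for all $y\in K$. For $x\in X$ and $r\ge0$ let $$\mathcal M(x,r):=\{G'(x)^*\lambda+\mu\in X^*\mid \lambda\in Y^*,\ \mu\in\mathcal N_C(x),\ \langle\lambda,y-G(x)\rangle_Y\le r\ \forall y\in K\}.$$ A point $\bar x\in\mathcal F$ is s-AKKT regular if $\limsup_{x\to\bar x,\ r\searrow0}\mathcal M(x,r)\subset\mathcal M(\bar x,0)$, where the left-hand side is the set of all $\bar v\in X^*$ for which there exist $\{x^k\}\subset X$, $\{r^k\}\subset[0,+\infty)$, $\{v^k\}\subset X^*$ with $x^k\to\bar x$, $r^k\to0$, $v^k\to\bar v$ (strongly) and $v^k\in\mathcal M(x^k,r^k)$ for all $k$. *)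

(* Defs.v *)
From mathcomp Require Import all_boot all_order all_algebra.
From mathcomp Require Import all_classical all_reals all_analysis.
Import Order.TTheory GRing.Theory Num.Theory numFieldNormedType.Exports.

Set Implicit Arguments.
Unset Strict Implicit.
Unset Printing Implicit Defensive.

Local Open Scope classical_set_scope.
Local Open Scope ring_scope.

(* The supremum is taken in R (sup is 0 on sets without a supremum), so this is
   the usual operator norm only when T is linear and continuous. For W := R it
   is the norm of the dual space. *)
Definition op_norm (R : realType) (V W : normedModType R) (T : V -> W) : R :=
  sup [set `|T x| | x in [set x : V | `|x| <= 1]].

Definition continuously_differentiable (R : realType) (V W : normedModType R)
    (f : V -> W) : Prop :=
  (forall x : V, differentiable f x) /\
  (forall x : V, op_norm ('d f y \- 'd f x) @[y --> x] --> (0 : R)).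

Section Problem.
Context {R : realType}.

(* The topological dual, as a set of plain functions. *)
Definition dual (V : normedModType R) : set (V -> R) :=
  [set v | linear (v : V -> R^o) /\ continuous v].

Definition dual_cvg (V : normedModType R) (v : nat -> V -> R) (w : V -> R) : Prop :=
  op_norm (v k \- w) @[k --> \oo] --> (0 : R).

Definition normal_cone (V : normedModType R) (S : set V) (x : V) : set (V -> R) :=
  [set v | [/\ dual v, S x & forall z, S z -> v (z - x) <= 0]].

Context {X Y : completeNormedModType R}.
Implicit Types (f : X -> R) (G : X -> Y) (C : set X) (K : set Y).

Definition feasible_set C K G : set X := [set x | C x /\ K (G x)].

Definition lagrangian f G (x : X) (lam : Y -> R) : R := f x + lam (G x).

Definition lagrangian_dx f G (x : X) (lam : Y -> R) : X -> R :=
  'd (fun z : X => lagrangian f G z lam) x.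

Definition KKT_point f C K G (xbar : X) : Prop :=
  feasible_set C K G xbar /\
  exists lam : Y -> R,
    [/\ dual lam,
        normal_cone C xbar (\- lagrangian_dx f G xbar lam) &
        normal_cone K (G xbar) lam].

Definition sAKKT_point f C K G (xbar : X) : Prop :=
  feasible_set C K G xbar /\
  exists (x : nat -> X) (lam : nat -> Y -> R) (eps : nat -> X -> R) (r : nat -> R),
    [/\ forall k, [/\ C (x k), dual (lam k), dual (eps k) & 0 <= r k],
        x k @[k --> \oo] --> xbar,
        dual_cvg eps (fun=> 0),
        r k @[k --> \oo] --> (0 : R) &
        forall k,
          normal_cone C (x k) (eps k \- lagrangian_dx f G (x k) (lam k)) /\
          (forall y, K y -> lam k (y - G (x k)) <= r k)].

(* [lam \o 'd G x] is the image of [lam] under the adjoint of [G'(x)]. *)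
Definition sAKKT_map C K G (x : X) (r : R) : set (X -> R) :=
  [set v | exists lam : Y -> R, exists mu : X -> R,
    [/\ dual lam,
        normal_cone C x mu,
        (forall y, K y -> lam (y - G x) <= r) &
        v = (lam \o 'd G x) \+ mu]].

Definition outer_limit (M : X -> R -> set (X -> R)) (xbar : X) : set (X -> R) :=
  [set vbar | dual vbar /\
    exists (x : nat -> X) (r : nat -> R) (v : nat -> X -> R),
      [/\ forall k, 0 <= r k /\ dual (v k),
          x k @[k --> \oo] --> xbar,
          r k @[k --> \oo] --> (0 : R),
          dual_cvg v vbar &
          forall k, M (x k) (r k) (v k)]].

Definition sAKKT_regular C K G (xbar : X) : Prop :=
  feasible_set C K G xbar /\
  outer_limit (sAKKT_map C K G) xbar `<=` sAKKT_map C K G xbar 0.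

End Problem.

(* Main.v *)
(** With [v_k = eps_k - f'(x_k)], the approximate stationarity condition reads
    [v_k \in M(x_k, r_k)] and the KKT condition reads [-f'(xbar) \in M(xbar, 0)].
    For (a), [v_k] converges to [-f'(xbar)] because [f'] is continuous.  For (b),
    a limit [v] of [v_k \in M(x_k, r_k)] is realised as [-g'(xbar)] by the
    linear objective [g = -v], for which [eps_k = v_k - v] witnesses s-AKKT. *)
From HB Require Import structures.
Require Import Defs.
From mathcomp Require Import all_boot all_order all_algebra.
From mathcomp Require Import all_classical all_reals all_analysis ring.
Import Order.TTheory GRing.Theory Num.Theory numFieldNormedType.Exports.

Local Open Scope classical_set_scope.
Local Open Scope ring_scope.

Section DualSpace.
Context {R : realType} {V : normedModType R}.
Implicit Types v w : V -> R.

(** Since [dual] holds plain functions, the linear structure has to be rebuilt before results on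
    continuous linear maps apply. *)
Lemma dual_linearE {v} : dual v -> exists L : {linear V -> R^o}, v = L.
Proof.
move=> [vlin _].
pose m := GRing.isLinear.Build R V R^o *:%R v vlin.
pose L : {linear V -> R^o} := HB.pack (v : V -> R^o) m.
by exists L.
Qed.

Lemma dual_linear {L : {linear V -> R^o}} : continuous L -> dual L.
Proof. by move=> cL; split => //; exact: linearP. Qed.

Lemma dualN {v} : dual v -> dual (\- v).
Proof.
move=> hv; have [L vE] := dual_linearE hv; case: hv => _ cv; rewrite vE in cv *.
by apply: (@dual_linear (\- L)) => x; apply: cvgN; exact: cv.
Qed.

Lemma dualD {v w} : dual v -> dual w -> dual (v \+ w).
Proof.
move=> hv hw; have [L vE] := dual_linearE hv; have [M wE] := dual_linearE hw.
case: hv hw => _ cv [_ cw]; rewrite vE wE in cv cw *.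
by apply: (@dual_linear (L \+ M)) => x; apply: cvgD; [exact: cv|exact: cw].
Qed.

Lemma dualB {v w} : dual v -> dual w -> dual (v \- w).
Proof. by move=> hv hw; exact: dualD hv (dualN hw). Qed.

Lemma dual_diff {f : V -> R} {x} : differentiable f x -> dual ('d f x).
Proof. by move=> df; apply: dual_linear; exact: diff_continuous. Qed.

Lemma diff_dual {v} x : dual v -> 'd v x = v :> (V -> R).
Proof.
move=> hv; have [L vE] := dual_linearE hv; case: hv => _; rewrite {}vE => cL.
exact: (diff_lin x cL).
Qed.

Lemma differentiable_dual {v} x : dual v -> differentiable v x.
Proof.
move=> hv; have [L vE] := dual_linearE hv; case: hv => _; rewrite {}vE => cL.
exact: (linear_differentiable x cL).
Qed.

Lemma op_norm0 : op_norm (fun _ : V => 0 : R) = 0.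
Proof.
rewrite /op_norm (_ : [set _ | _ in _] = [set 0]) ?sup1//.
apply/seteqP; split => [_ [x _ <-]|_ ->] /=; first by rewrite normr0.
by exists 0; rewrite /= normr0.
Qed.

(** Continuity at 0 gives a bound [M * |x|]. This makes the supremum in [op_norm] a genuine one
    rather than the default 0. *)
Lemma dual_has_ubound {v} : dual v ->
  has_ubound [set `|v x| | x in [set x : V | `|x| <= 1]].
Proof.
move=> hv; have [L vE] := dual_linearE hv; case: hv => _; rewrite {}vE => cL.
have /linear_boundedP/pinfty_ex_gt0[M M0 LM] :
  bounded_near L (nbhs (0 : V)) by apply: continuous_linear_bounded; exact: cL.
exists M => _ [x x1 <-]; apply: le_trans (LM x) _.
by rewrite -[leRHS]mulr1 ler_wpM2l// ltW.
Qed.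

Lemma op_norm_ge0 {v} : dual v -> 0 <= op_norm v.
Proof.
move=> hv; apply: le_trans (normr_ge0 (v 0)) _.
by apply: (ub_le_sup (dual_has_ubound hv)); exists 0; rewrite /= ?normr0.
Qed.

Lemma op_normD {v w} : dual v -> dual w ->
  op_norm (v \+ w) <= op_norm v + op_norm w.
Proof.
(* The value at 0 shows that the set of values is nonempty. *)
move=> hv hw; apply: ge_sup; first by exists `|(v \+ w) 0|, 0; rewrite /= ?normr0.
move=> _ [x x1 <-]; apply: le_trans (ler_normD _ _) _.
by apply: lerD; [apply: (ub_le_sup (dual_has_ubound hv))
  |apply: (ub_le_sup (dual_has_ubound hw))]; exists x.
Qed.

Lemma op_normN v : op_norm (\- v) = op_norm v.
Proof.
by rewrite /op_norm; congr sup; apply: eq_imagel => x _ /=; rewrite normrN.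
Qed.

(** Squeeze: the norm of the difference lies between 0 and the sum of the two error norms. *)
Lemma dual_cvgB {u : nat -> V -> R} {u0} {w : nat -> V -> R} {w0} :
  (forall k, dual (u k)) -> dual u0 -> (forall k, dual (w k)) -> dual w0 ->
  dual_cvg u u0 -> dual_cvg w w0 ->
  dual_cvg (fun k => u k \- w k) (u0 \- w0).
Proof.
move=> hu hu0 hw hw0 cu cw; rewrite /dual_cvg.
have E k : (u k \- w k) \- (u0 \- w0) = (u k \- u0) \+ (\- (w k \- w0)).
  by apply/funext => x /=; ring.
have duw k : dual (u k \- u0) /\ dual (\- (w k \- w0)).
  by split; [|apply: dualN]; exact: dualB.
apply: (@squeeze_cvgr _ _ _ _ (fun=> 0)
  (fun k => op_norm (u k \- u0) + op_norm (w k \- w0))).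
- near=> k; have [? ?] := duw k.
  rewrite E op_norm_ge0/=; last exact: dualD.
  by rewrite -(op_normN (w k \- w0)); exact: op_normD.
- exact: cvg_cst.
- by rewrite -[0 in X in _ --> X]addr0; exact: cvgD cu cw.
Unshelve. all: by end_near. Qed.

(** The derivative of [v] is [v] at every point, so differences of derivatives vanish. *)
Lemma dual_continuously_differentiable {v} :
  dual v -> continuously_differentiable v.
Proof.
move=> hv; split=> [x|x]; first exact: differentiable_dual.
rewrite (_ : (fun y => _) = fun=> 0); first exact: cvg_cst.
apply/funext => y; rewrite -[RHS]op_norm0; congr op_norm.
by apply/funext => z /=; rewrite !diff_dual// subrr.
Qed.

End DualSpace.

(** Sum and chain rules, [lam] being its own derivative. *)
Lemma lagrangian_dxE {R : realType} {X Y : completeNormedModType R}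
    {f : X -> R} {G : X -> Y} {x : X} {lam : Y -> R} :
  differentiable f x -> differentiable G x -> dual lam ->
  lagrangian_dx f G x lam = 'd f x \+ (lam \o 'd G x).
Proof.
move=> df dG hlam; have dlam := differentiable_dual (G x) hlam.
apply/funext => z.
have dD := congr1 (@^~ z) (diffD df (differentiable_comp dG dlam)).
have dC := congr1 (@^~ z) (diff_comp dG dlam).
transitivity ('d f x z + 'd (lam \o G) x z); first exact: dD.
congr (_ + _); transitivity ('d lam (G x) ('d G x z)); first exact: dC.
by rewrite diff_dual.
Qed.

Theorem theorem4p6 (R : realType) (X Y : completeNormedModType R)
    (f : X -> R) (G : X -> Y) (C : set X) (K : set Y) (xbar : X)
    (hf : continuously_differentiable f)
    (hG : continuously_differentiable G)
    (hC0 : C !=set0) (hCcl : closed C) (hCcv : convex_set C)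
    (hK0 : K !=set0) (hKcl : closed K) (hKcv : convex_set K)
    (hxbar : feasible_set C K G xbar) :
  (sAKKT_point f C K G xbar -> sAKKT_regular C K G xbar ->
     KKT_point f C K G xbar) /\
  ((forall g : X -> R, continuously_differentiable g ->
      sAKKT_point g C K G xbar -> KKT_point g C K G xbar) ->
     sAKKT_regular C K G xbar).
Proof.
have [dG _] := hG; split.
  have [df cdf] := hf.
  move=> [_ [x [lam [eps [r [hk cx ceps cr hn]]]]]] [_ reg]; split=> //.
  have deps k : dual (eps k) by case: (hk k).
  have dfx y : dual ('d f y) := dual_diff (df y).
  have dual0 : dual (fun _ : X => 0 : R).
    by apply: (@dual_linear _ _ (\0)) => z; exact: cvg_cst.
  have [lam0 [mu [hlam0 hmu lamK vE]]] : sAKKT_map C K G xbar 0 (\- 'd f xbar).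
    apply: reg; split; first exact/dualN/dfx.
    exists x, r, (fun k => eps k \- 'd f (x k)); split=> //.
    - by move=> k; split; [case: (hk k)|exact: dualB].
    (* Continuity of the derivative of [f], composed with [x k --> xbar], gives the limit of the
       second term. *)
    - have := dual_cvgB deps dual0 (fun k => dfx (x k)) (dfx xbar) ceps
        (cvg_comp _ _ cx (cdf xbar)).
      by rewrite (_ : _ \- _ = \- 'd f xbar)//; apply/funext => z /=; rewrite sub0r.
    - move=> k; have [_ hlam _ _] := hk k; have [hN hr] := hn k.
      (* Adding [lam k \o 'd G (x k)] to this normal vector leaves [eps k \- 'd f (x k)]. *)
      exists (lam k), (eps k \- lagrangian_dx f G (x k) (lam k)); split=> //.
      apply/funext => z /=; rewrite lagrangian_dxE//=; ring.
  (* With [r = 0], the bound on [lam0] together with feasibility is membership in the normal cone of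
     [K]. *)
  exists lam0; split=> //; last first.
    by split=> //; case: hxbar.
  rewrite (_ : \- _ = mu)//; apply/funext => z /=.
  rewrite lagrangian_dxE//= opprD.
  by have /= -> := congr1 (fun h => h z) vE; rewrite addrAC subrr add0r.
move=> H; split=> // v [hv [x [r [w [hk cx cr cw hM]]]]].
have dv z : 'd (\- v) z = \- v :> (X -> R) by rewrite diff_dual//; exact: dualN.
have Lv z l : dual l -> lagrangian_dx (\- v) G z l = \- v \+ (l \o 'd G z).
  by move=> hl; rewrite lagrangian_dxE ?dv//; exact/differentiable_dual/dualN.
have /H : continuously_differentiable (\- v).
  exact/dual_continuously_differentiable/dualN.
case.
  split=> //.
  (* Only the multipliers are chosen as a sequence; each [mu] stays existential and is recovered
     below as [eps k] minus the Lagrangian derivative. *)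
  have /choice[lam hlam] := hM.
  exists x, lam, (fun k => w k \- v), r; split=> //.
  (* [C (x k)] comes from the normal cone, which is empty outside [C]. *)
  - move=> k; have [hr hw] := hk k; have [mu [? [_ Cx _] _ _]] := hlam k.
    by split=> //; exact: dualB.
  - rewrite /dual_cvg (_ : (fun k => _) = fun k => op_norm (w k \- v))//.
    apply/funext => k; congr op_norm.
    by apply/funext => z /=; rewrite subr0.
  - move=> k; have [mu [hl hmu lamK wE]] := hlam k; split=> //.
    rewrite Lv// wE (_ : _ \- _ = mu)//; apply/funext => z /=.
    ring.
move=> _ [lam [hlam hC hKl]].
(* For the objective [\- v] this normal vector equals [v] minus [lam \o 'd G xbar], which gives the
   required decomposition of [v]. *)
exists lam, (\- lagrangian_dx (\- v) G xbar lam); split=> //.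
  by case: hKl.
by apply/funext => z /=; rewrite Lv//= opprD opprK addrCA subrr addr0.
Qed.
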